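(* Let $F_m$ denote the $m$-th Fibonacci polynomial and $F_m'$ its derivative. For any odd numbers $s,s_1,s_2\in 1+2\mathbb{Z}_2$: 1. $F_{3\cdot 2^{l-1}}'(s)\equiv 0 \pmod{2^l}$ and $F_{3\cdot 2^{l-1}+1}'(s)\equiv 2^{l-1} \pmod{2^l}$ for any positive integer $l$; 2. the sequence $\{F_m'(s) \bmod 2^l\}_{m\ge 0}$ is periodic of period $3\cdot 2^l$ for any positive integer $l$; 3. the sequence $\{F_m'(s_1)\cdot F_m'(s_2) \bmod 4\}_{m\ge 0}$ is periodic of period $6$.
   Context: $\mathbb{Z}_2$ is the ring of 2-adic integers. The Fibonacci polynomials are defined by $F_0(x)=0$, $F_1(x)=1$, $F_m(x)=xF_{m-1}(x)+F_{m-2}(x)$ for $m\ge 2$. A sequence $\{f_m\}_{m\ge 0}$ is called periodic of period $d$ if $d$ is the least positive integer such that $f_{m+d}=f_m$ for every $m$. *)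

(* Defs.v *)
From HB Require Import structures.
From mathcomp Require Import all_boot all_order all_algebra.
From mathcomp Require Import boolp.

Set Implicit Arguments.
Unset Strict Implicit.
Unset Printing Implicit Defensive.

Import GRing.Theory.
Local Open Scope ring_scope.

(* The ring of 2-adic integers as the inverse limit of the rings Z/2^n: an
   element is a compatible family of residues, the residue mod 2^n being
   represented by its least nonnegative representative; compatibility of the
   family already forces residue n < 2^n. *)
Record Z2 := MkZ2 {
  z2val :> nat -> nat;
  z2P : forall n, (z2val n.+1 %% 2 ^ n = z2val n)%N }.

Definition residue (l : nat) (x : Z2) : nat := x l.

Lemma z2_eq (x y : Z2) : (forall n, residue n x = residue n y) -> x = y.
Proof.
case: x y => [x xP] [y yP] /= /funext; rewrite /residue /= => xy.
by case: _ / xy yP => yP; congr MkZ2; apply: Prop_irrelevance.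
Qed.

Lemma residue_mod n (x : Z2) : (residue n x %% 2 ^ n = residue n x)%N.
Proof. by rewrite /residue -[in LHS]z2P modn_mod z2P. Qed.

Lemma residue_le m n (x : Z2) :
  (m <= n)%N -> (residue n x %% 2 ^ m = residue m x)%N.
Proof.
move=> /subnKC <-; elim: (n - m)%N => [|k IH]; first by rewrite addn0 residue_mod.
rewrite addnS -IH /residue -(z2P x (m + k)) modn_dvdm //.
by rewrite dvdn_exp2l // leq_addr.
Qed.

HB.instance Definition _ := gen_eqMixin Z2.
HB.instance Definition _ := gen_choiceMixin Z2.

Lemma of_family_subproof (f : nat -> nat) :
  (forall n, f n.+1 = f n %[mod 2 ^ n])%N ->
  forall n, ((f n.+1 %% 2 ^ n.+1) %% 2 ^ n = f n %% 2 ^ n)%N.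
Proof. by move=> fP n; rewrite modn_dvdm ?fP // dvdn_exp2l. Qed.

Definition of_family f fP : Z2 := MkZ2 (@of_family_subproof f fP).

Lemma z2E n (x : Z2) : x n.+1 = x n %[mod 2 ^ n].
Proof. by rewrite z2P residue_mod. Qed.

Lemma nat_subproof (k n : nat) : k = k %[mod 2 ^ n].
Proof. by []. Qed.
Lemma add_subproof (x y : Z2) n :
  (x n.+1 + y n.+1)%N = (x n + y n)%N %[mod 2 ^ n].
Proof. by rewrite -modnDm !z2E modnDm. Qed.
Lemma mul_subproof (x y : Z2) n :
  (x n.+1 * y n.+1)%N = (x n * y n)%N %[mod 2 ^ n].
Proof. by rewrite -modnMm !z2E modnMm. Qed.
(* - x is represented by (2^n - 1) x since subtraction is truncated on nat *)
Lemma opp_subproof (x : Z2) n :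
  ((2 ^ n.+1).-1 * x n.+1)%N = ((2 ^ n).-1 * x n)%N %[mod 2 ^ n].
Proof.
rewrite -modnMm z2E modnMmr; congr (_ %% _)%N.
suff -> : ((2 ^ n.+1).-1 = (2 ^ n).-1 %[mod 2 ^ n])%N by rewrite modn_small ?prednK ?expn_gt0.
rewrite expnS mul2n -addnn -[X in (X + _)%N]prednK ?expn_gt0 //.
by rewrite addSn /= modnDr.
Qed.

Definition z2nat k := of_family (nat_subproof k).
Definition z2add x y := of_family (add_subproof x y).
Definition z2mul x y := of_family (mul_subproof x y).
Definition z2opp x := of_family (opp_subproof x).

Ltac z2ring := move=> *; apply: z2_eq => n; rewrite /residue /=.

Lemma z2addA : associative z2add.
Proof. by z2ring; rewrite modnDmr modnDml addnA. Qed.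
Lemma z2addC : commutative z2add.
Proof. by z2ring; rewrite addnC. Qed.
Lemma z2add0 : left_id (z2nat 0) z2add.
Proof. by z2ring; rewrite mod0n add0n residue_mod. Qed.
Lemma z2addN : left_inverse (z2nat 0) z2opp z2add.
Proof.
by z2ring; rewrite modnDml addnC -mulSn prednK ?expn_gt0 // modnMr mod0n.
Qed.

HB.instance Definition _ :=
  GRing.isZmodule.Build Z2 z2addA z2addC z2add0 z2addN.

Lemma z2mulA : associative z2mul.
Proof. by z2ring; rewrite modnMmr modnMml mulnA. Qed.
Lemma z2mulC : commutative z2mul.
Proof. by z2ring; rewrite mulnC. Qed.
Lemma z2mul1 : left_id (z2nat 1) z2mul.
Proof. by z2ring; rewrite modnMml mul1n residue_mod. Qed.
Lemma z2mulDl : left_distributive z2mul z2add.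
Proof. by z2ring; rewrite modnMml modnDm mulnDl. Qed.
Lemma z2_1neq0 : z2nat 1 != 0.
Proof. by apply/eqP => /(congr1 (residue 1)). Qed.

HB.instance Definition _ :=
  GRing.Zmodule_isComNzRing.Build Z2 z2mulA z2mulC z2mul1 z2mulDl z2_1neq0.

Lemma residueD l (x y : Z2) :
  residue l (x + y) = ((residue l x + residue l y) %% 2 ^ l)%N.
Proof. by []. Qed.

Lemma residueM l (x y : Z2) :
  residue l (x * y) = ((residue l x * residue l y) %% 2 ^ l)%N.
Proof. by []. Qed.

Lemma residue_nat l k : residue l k%:R = (k %% 2 ^ l)%N.
Proof.
elim: k => [//|k IH]; rewrite mulrSr residueD IH.
by rewrite [residue l 1]/(1 %% 2 ^ l)%N modnDm addn1.
Qed.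

Definition congr_mod (R : comNzRingType) (a x y : R) : Prop :=
  exists z : R, x - y = a * z.

(* dividing by 2^l shifts the family of residues by l *)
Lemma quot_subproof l (x : Z2) : residue l x = 0%N ->
  forall n, (x (n.+1 + l) %/ 2 ^ l = x (n + l) %/ 2 ^ l %[mod 2 ^ n])%N.
Proof.
move=> x0 n; pose q k := (x (k + l) %/ 2 ^ l)%N.
have qP k : x (k + l)%N = (q k * 2 ^ l)%N.
  rewrite {1}(divn_eq (x (k + l)%N) (2 ^ l)).
  by rewrite (residue_le x (leq_addl k l)) x0 addn0.
apply/eqP; rewrite -/(q n.+1) -/(q n).
have := z2E (n + l) x; rewrite -addSn !qP expnD => /eqP.
by rewrite -!muln_modl eqn_pmul2r ?expn_gt0.
Qed.

(* so sequences in Z2 / 2^l Z2 may be compared through their residues *)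
Lemma residue_congr l (x y : Z2) :
  residue l x = residue l y <-> congr_mod (2 ^+ l) x y.
Proof.
have pE : (2 ^+ l : Z2) = (2 ^ l)%:R by rewrite natrX.
split=> [xy|[z xyz]]; last first.
  rewrite -[x](subrK y) xyz pE residueD residueM residue_nat modnn mul0n.
  by rewrite mod0n add0n residue_mod.
suff qP (d : Z2) : residue l d = 0%N -> exists z, d = 2 ^+ l * z.
  by apply: qP; rewrite residueD xy -residueD subrr /residue /= mod0n.
move=> d0; exists (of_family (quot_subproof d0)); apply: z2_eq => n.
rewrite pE residueM residue_nat modnMml /residue /= modnMmr.
rewrite mulnC divnK; last first.
  by apply/eqP; rewrite (residue_le d (leq_addl n l)) d0.
by rewrite (residue_le d (leq_addr l n)).
Qed.

Fixpoint fibpoly (R : nzRingType) (m : nat) : {poly R} :=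
  match m with
  | 0 => 0
  | m'.+1 => if m' is k.+1 then 'X * fibpoly R m' + fibpoly R k else 1
  end.

Lemma fibpolySS (R : nzRingType) m :
  fibpoly R m.+2 = 'X * fibpoly R m.+1 + fibpoly R m.
Proof. by []. Qed.

Definition is_period (T : Type) (f : nat -> T) (d : nat) : Prop :=
  (0 < d)%N /\ forall m, f (m + d)%N = f m.

Definition periodic_of_period (T : Type) (f : nat -> T) (d : nat) : Prop :=
  is_period f d /\ forall e, is_period f e -> (d <= e)%N.

(* Main.v *)
Require Import Defs.
From mathcomp Require Import all_boot all_order all_algebra.
From mathcomp Require Import ring zify.
Local Open Scope ring_scope.

(** Over the dual numbers Z2[e], e^2 = 0, one has F_m(s + e) = F_m(s) + F_m'(s) e,
    and the powers of the companion matrix M of X^2 - (s + e) X - 1 have the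
    Fibonacci values F_m(s + e) as entries.  All three parts come from the single
    congruence M^(3 * 2^k) = 1 + 2^k e modulo 2^(k+1).  It holds for k = 0 by
    inspection of F_3 and F_4, because s is odd, and it propagates from k to k + 1
    by squaring.  Entrywise it is the invariant [fib_values_3_2k]; the squaring is
    the addition formula [fibpoly_add] together with its derivative
    [dfib_add].

    Part 1 consists of two of the four congruences of the invariant, for k = l - 1.
    For part 2, the invariant at k = l makes M^(3 * 2^l) congruent to 1 modulo 2^l,
    so 3 * 2^l is a period.
    A period N is the least one as soon as no N / p with p a prime divisor of N is
    a period ([periodic_of_period_prime]).  Here N / 2 is excluded by part 1, and
    N / 3 = 2^l is excluded modulo 2: together with the period 6 it would
    make 2 a period, whereas F_2' = 1 and F_0' = 0.  For part 3, the invariant at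
    k = 1 gives F_(m+6)'(s) = F_m'(s) + 2 F_m(s) modulo 4.  As F_m(s) and F_m'(s)
    modulo 2 are the same for all odd s, the two corrections cancel modulo 4 in the
    product, so 6 is a period.  The divisors 3 and 2 of 6 are excluded by F_4' and
    F_2', which are odd, against F_1' = F_0' = 0. *)

Set Implicit Arguments.
Unset Strict Implicit.
Unset Printing Implicit Defensive.

Import GRing.Theory.

(** * Periods of sequences *)

Section Periods.
Variables (T : Type) (f : nat -> T).

Lemma is_period_mul a q m : is_period f a -> f (m + q * a)%N = f m.
Proof.
move=> [_ fa]; elim: q => [|q IH]; first by rewrite addn0.
by rewrite mulSn addnCA addnC fa.
Qed.

Lemma is_period_dvd a b :
  is_period f a -> (0 < b)%N -> (a %| b)%N -> is_period f b.
Proof. by move=> fa b0 /dvdnP[q bE]; split=> // m; rewrite bE is_period_mul. Qed.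

(** Bezout in the form a | gcd(a, b) + u b: shifting by gcd(a, b) is the same as
    shifting by a multiple of a. *)
Lemma is_period_gcd a b :
  is_period f a -> is_period f b -> is_period f (gcdn a b).
Proof.
move=> fa fb; have a0 : (0 < a)%N by case: fa.
split=> [|m]; first by rewrite gcdn_gt0 a0.
have [u _ /dvdnP[q uE]] := Bezoutl b a0.
by rewrite -(is_period_mul u (m + gcdn a b) fb) -addnA uE is_period_mul.
Qed.

(** If e is a smaller period, then gcd(e, N) is a period properly dividing N, hence
    it divides N / p for some prime p. *)
Lemma periodic_of_period_prime N :
    is_period f N ->
    (forall p, prime p -> (p %| N)%N -> ~ is_period f (N %/ p)%N) ->
  periodic_of_period f N.
Proof.
move=> fN Nmin; split=> // e fe.
have N0 : (0 < N)%N by case: fN.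
have e0 : (0 < e)%N by case: fe.
have /dvdnP[q NE] := dvdn_gcdr e N.
have [q1 | q1] := leqP q 1.
  rewrite dvdn_leq //; apply/gcdn_idPr; rewrite {2}NE.
  by case: q q1 NE => [|[|]] // _; [lia | rewrite mul1n].
case: (Nmin (pdiv q)).
- exact: pdiv_prime.
- by rewrite NE dvdn_mulr // pdiv_dvd.
have /dvdnP[r qE] := pdiv_dvd q.
have p0 := pdiv_gt0 q.
have Np : (N %/ pdiv q = r * gcdn e N)%N.
  by rewrite {1}NE {1}qE mulnAC mulnK.
rewrite Np; apply: (is_period_dvd (is_period_gcd fe fN)); last exact: dvdn_mull.
by rewrite -Np divn_gt0 // dvdn_leq // NE dvdn_mulr // pdiv_dvd.
Qed.

End Periods.

(** * Values of Fibonacci polynomials and of their derivatives *)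

Section Fibonacci.
Variable R : comNzRingType.
Implicit Types (s t : R) (m n k : nat).

Local Notation F := (fibpoly R).

Lemma fibpoly_add m n : F (m + n).+1 = F m.+1 * F n.+1 + F m * F n.
Proof.
suff [] : F (m + n).+1 = F m.+1 * F n.+1 + F m * F n /\
          F (m + n).+2 = F m.+2 * F n.+1 + F m.+1 * F n by [].
elim: m => [|m [IH1 IH2]].
  by rewrite add0n !fibpolySS /=; split; ring.
by split; rewrite addSn // fibpolySS IH1 IH2 (fibpolySS _ m.+1) fibpolySS; ring.
Qed.

Definition fib m s : R := (F m).[s].
Definition dfib m s : R := (F m)^`().[s].

Lemma fibSS m s : fib m.+2 s = s * fib m.+1 s + fib m s.
Proof. by rewrite /fib fibpolySS !hornerE. Qed.

Lemma dfibSS m s : dfib m.+2 s = fib m.+1 s + s * dfib m.+1 s + dfib m s.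
Proof. by rewrite /dfib /fib fibpolySS !derivE !hornerE. Qed.

Lemma fib_add m n s :
  fib (m + n).+1 s = fib m.+1 s * fib n.+1 s + fib m s * fib n s.
Proof. by rewrite /fib fibpoly_add !hornerE. Qed.

Lemma dfib_add m n s :
  dfib (m + n).+1 s = dfib m.+1 s * fib n.+1 s + fib m.+1 s * dfib n.+1 s
                      + dfib m s * fib n s + fib m s * dfib n s.
Proof.
by rewrite /dfib /fib fibpoly_add derivD !derivM !(hornerD, hornerM) !addrA.
Qed.

Lemma fib0 s : fib 0 s = 0. Proof. by rewrite /fib horner0. Qed.
Lemma fib1 s : fib 1 s = 1. Proof. by rewrite /fib hornerC. Qed.
Lemma dfib0 s : dfib 0 s = 0. Proof. by rewrite /dfib deriv0 horner0. Qed.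
Lemma dfib1 s : dfib 1 s = 0. Proof. by rewrite /dfib derivC horner0. Qed.
Lemma dfib2 s : dfib 2 s = 1.
Proof. by rewrite dfibSS fib1 dfib1 dfib0; ring. Qed.

(** The entries of M^(3 * 2^k) = 1 + 2^k e modulo 2^(k+1) over the dual numbers. *)
Lemma fib_values_3_2k s k : (exists t, s = 1 + 2 * t) ->
  let n := (3 * 2 ^ k)%N in
  [/\ congr_mod (2 ^+ k.+1) (fib n s) 0,
      congr_mod (2 ^+ k.+1) (fib n.+1 s) 1,
      congr_mod (2 ^+ k.+1) (dfib n s) 0 &
      congr_mod (2 ^+ k.+1) (dfib n.+1 s) (2 ^+ k)].
Proof.
move=> [t sE] /=; elim: k => [|k [[a aE] [b bE] [c cE] [d dE]]].
  rewrite muln1 !dfibSS !fibSS fib0 fib1 dfib1 dfib0 sE.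
  split.
  - by exists (1 + 2 * t + 2 * t ^+ 2); ring.
  - by exists (1 + 5 * t + 6 * t ^+ 2 + 4 * t ^+ 3); ring.
  - by exists (1 + 2 * t); ring.
  - by exists (2 + 6 * t + 6 * t ^+ 2); ring.
rewrite expnS mulnCA mul2n -addnn; move: (3 * 2 ^ k)%N aE bE cE dE => n.
move=> /(canRL (subrK _)) aE /(canRL (subrK _)) bE.
move=> /(canRL (subrK _)) cE /(canRL (subrK _)) dE.
(* the values at 2 n come from those at 2 n + 1 and 2 n + 2 by the recurrence *)
have f2n : fib (n + n) s = 2 * fib n s * fib n.+1 s - s * fib n s ^+ 2.
  have := fib_add n n.+1 s; rewrite addnS fibSS (fibSS n) fib_add.
  by move/(canRL (addKr _)) => ->; ring.
have d2n : dfib (n + n) s =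
    2 * dfib n s * fib n.+1 s + 2 * fib n s * dfib n.+1 s
    - fib n s ^+ 2 - 2 * s * fib n s * dfib n s.
  have := dfib_add n n.+1 s.
  rewrite addnS dfibSS (dfibSS n) (fibSS n) fib_add dfib_add.
  by move/(canRL (addKr _)) => ->; ring.
rewrite f2n d2n fib_add dfib_add aE bE cE dE !exprS.
set p := 2 ^+ k; split.
- by exists (a * (1 + 2 * p * b) - s * p * a ^+ 2); ring.
- by exists (b + p * b ^+ 2 + p * a ^+ 2); ring.
- exists (c * (1 + 2 * p * b) + a * (p + 2 * p * d) - p * a ^+ 2
          - 2 * s * p * a * c); ring.
- by exists (d + p * b + 2 * p * b * d + 2 * p * a * c); ring.
Qed.

(** Both values are polynomial expressions in s with integer coefficients.  Used for
    two odd numbers, which are always congruent modulo 2. *)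
Lemma fib_congr2 s s' m : congr_mod 2 s s' ->
  congr_mod 2 (fib m s) (fib m s') /\ congr_mod 2 (dfib m s) (dfib m s').
Proof.
move=> [t /(canRL (subrK _)) ->].
suff [] : (congr_mod 2 (fib m (2 * t + s')) (fib m s') /\
           congr_mod 2 (dfib m (2 * t + s')) (dfib m s')) /\
          (congr_mod 2 (fib m.+1 (2 * t + s')) (fib m.+1 s') /\
           congr_mod 2 (dfib m.+1 (2 * t + s')) (dfib m.+1 s')) by [].
elim: m => [|m [[[a aE] [b bE]] [[c cE] [d dE]]]].
  by rewrite !fib0 !fib1 !dfib0 !dfib1; do ![split]; exists 0; ring.
split; first by split; [exists c | exists d].
move: aE bE cE dE.
move=> /(canRL (subrK _)) aE /(canRL (subrK _)) bE.
move=> /(canRL (subrK _)) cE /(canRL (subrK _)) dE.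
rewrite !dfibSS !fibSS aE bE cE dE; split.
- by exists (t * (2 * c + fib m.+1 s') + s' * c + a); ring.
- by exists (c + t * (2 * d + dfib m.+1 s') + s' * d + b); ring.
Qed.

(** M^(3 * 2^l) is congruent to 1 modulo 2^l. *)
Lemma dfib_period s l m : (exists t, s = 1 + 2 * t) ->
  congr_mod (2 ^+ l) (dfib (m + 3 * 2 ^ l) s) (dfib m s).
Proof.
move=> /(fib_values_3_2k l) /= [[a aE] [b bE] [c cE] [d dE]].
move: aE bE cE dE; move: (3 * 2 ^ l)%N => n.
rewrite exprS; set p := 2 ^+ l.
move=> /(canRL (subrK _)) aE /(canRL (subrK _)) bE.
move=> /(canRL (subrK _)) cE /(canRL (subrK _)) dE.
case: m => [|m]; first by rewrite add0n dfib0 cE; exists (2 * c); ring.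
rewrite addSn dfib_add aE bE cE dE.
exists (2 * b * dfib m.+1 s + fib m.+1 s * (2 * d + 1)
        + 2 * a * dfib m s + 2 * c * fib m s); ring.
Qed.

(** M^6 is congruent to 1 + 2 e modulo 4. *)
Lemma dfib_shift6 s m : (exists t, s = 1 + 2 * t) ->
  congr_mod (2 ^+ 2) (dfib (m + 6) s) (dfib m s + 2 * fib m s).
Proof.
move=> /(fib_values_3_2k 1) /= [[a aE] [b bE] [c cE] [d dE]].
move: aE bE cE dE; have -> : (3 * 2 ^ 1)%N = 6 by [].
move=> /(canRL (subrK _)) aE /(canRL (subrK _)) bE.
move=> /(canRL (subrK _)) cE /(canRL (subrK _)) dE.
case: m => [|m]; first by rewrite add0n dfib0 fib0 cE; exists c; ring.
rewrite addSn dfib_add aE bE cE dE.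
exists (b * dfib m.+1 s + fib m.+1 s * d + a * dfib m s + c * fib m s); ring.
Qed.

(** Shifting by 6 adds 2 (D F' + D' F) to D D' modulo 4, where D, F and D', F' are
    the values at s and s'; since D = D' and F = F' modulo 2, this is 4 D F. *)
Lemma dfib_mul_period6 s s' m :
    (exists t, s = 1 + 2 * t) -> (exists t, s' = 1 + 2 * t) ->
  congr_mod (2 ^+ 2) (dfib (m + 6) s * dfib (m + 6) s') (dfib m s * dfib m s').
Proof.
move=> hs hs'; have [a] := dfib_shift6 m hs; have [b] := dfib_shift6 m hs'.
have [|[c cE] [d dE]] := @fib_congr2 s s' m.
  by case: hs hs' => [t ->] [t' ->]; exists (t - t'); ring.
move: cE dE => /(canRL (subrK _)) -> /(canRL (subrK _)) ->.
move=> /(canRL (subrK _)) -> /(canRL (subrK _)) ->.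
set D := dfib m s'; set G := fib m s'.
exists (a * (4 * b + D + 2 * G) + b * (2 * d + D + 2 * (2 * c + G))
        + d * G + c * D + D * G + (2 * c + G) * G); ring.
Qed.

End Fibonacci.

(** * Least periods *)

Lemma dfib_periodic (s : Z2) l : (exists t, s = 1 + 2 * t) -> (0 < l)%N ->
  periodic_of_period (fun m => residue l (dfib m s)) (3 * 2 ^ l)%N.
Proof.
move=> hs l0.
have period j : is_period (fun m => residue j (dfib m s)) (3 * 2 ^ j)%N.
  split=> [|m]; first by rewrite muln_gt0 expn_gt0.
  by apply/residue_congr/dfib_period.
apply: periodic_of_period_prime => // p p_pr.
rewrite Euclid_dvdM // Euclid_dvdX // !dvdn_prime2 // l0 andbT.
case/orP=> /eqP-> {p p_pr}.
  (* p = 3: a period 2^l would also be one modulo 2, where 6 is a period *)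
  rewrite mulKn // => -[_ P].
  have per2l : is_period (fun m => residue 1 (dfib m s)) (2 ^ l)%N.
    by split=> [|m]; [rewrite expn_gt0 | rewrite -!(residue_le _ l0) P].
  have [_ /(_ 0%N)] := is_period_gcd per2l (period 1%N).
  have -> : gcdn (2 ^ l) (3 * 2 ^ 1) = 2%N.
    rewrite -(prednK l0) expnS mulnC -muln_gcdl.
    by have /eqP-> : coprime (2 ^ l.-1) 3 by rewrite coprimeXl.
  by rewrite dfib2 dfib0.
(* p = 2: the values at 1 and 3 * 2^(l-1) + 1 are 0 and 2^(l-1) *)
case: l l0 period => // l _ _.
rewrite expnS mulnCA mulKn // => -[_ /(_ 1%N)].
have [_ _ _ /residue_congr] := fib_values_3_2k l hs.
rewrite add1n dfib1 => -> /eqP.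
rewrite -natrX residue_nat modn_small ?ltn_exp2l // => /eqP l0.
by have := expn_gt0 2 l; rewrite l0 /residue /= mod0n.
Qed.

Lemma dfib_mul_periodic (s s' : Z2) :
    (exists t, s = 1 + 2 * t) -> (exists t, s' = 1 + 2 * t) ->
  periodic_of_period (fun m => residue 2 (dfib m s * dfib m s')) 6.
Proof.
move=> hs hs'; apply: periodic_of_period_prime => [|p p_pr].
  by split=> // m; apply/residue_congr/dfib_mul_period6.
rewrite (@Euclid_dvdM 2 3) // !dvdn_prime2 //.
case/orP=> /eqP-> {p p_pr} [_].
  (* p = 2: parity separates m = 1 from m = 4 *)
  move=> /(_ 1%N) /(congr1 (fun r => r %% 2 ^ 1)%N).
  have [_ _ _ /residue_congr d4] := fib_values_3_2k 0 hs.
  have [_ _ _ /residue_congr d4'] := fib_values_3_2k 0 hs'.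
  by rewrite !residue_le // !residueM dfib1 (_ : (1 + _)%N = 4) // d4 d4'.
by move=> /(_ 0%N); rewrite add0n !dfib2 !dfib0 mulr1 mul0r.
Qed.

Theorem lemma2p9 (s s1 s2 : Z2)
    (hs : exists t : Z2, s = 1 + 2 * t)
    (hs1 : exists t : Z2, s1 = 1 + 2 * t)
    (hs2 : exists t : Z2, s2 = 1 + 2 * t) :
  (forall l : nat, (0 < l)%N ->
     congr_mod (2 ^+ l) (fibpoly Z2 (3 * 2 ^ l.-1))^`().[s] 0 /\
     congr_mod (2 ^+ l) (fibpoly Z2 (3 * 2 ^ l.-1 + 1))^`().[s] (2 ^+ l.-1))
  /\
  (forall l : nat, (0 < l)%N ->
     periodic_of_period
       (fun m : nat => residue l (fibpoly Z2 m)^`().[s]) (3 * 2 ^ l)%N)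
  /\
  periodic_of_period
    (fun m : nat =>
       residue 2 ((fibpoly Z2 m)^`().[s1] * (fibpoly Z2 m)^`().[s2])) 6.
Proof.
split; [|split].
- by case=> // l _; rewrite addn1; have [] := fib_values_3_2k l hs.
- by move=> l l0; apply: dfib_periodic.
- exact: dfib_mul_periodic.
Qed.
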